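(* In the linear model with measurement errors and the general subsampling scheme described in the context, let $V$ and $V_c$ be the asymptotic covariance matrices defined there, viewed as functions of the subsampling probabilities $\pi_1,\ldots,\pi_n$ (with $\sum_{i=1}^n\pi_i=1$). (i) If the subsampling probabilities are selected as $$\pi_{i}^{mV}=\frac{|y_{i}-\mathbf{W}_{i}^{T}\hat{\boldsymbol{\beta}}|\,\|\mathcal{H}_{W}^{-1}\mathbf{W}_{i}\|}{\sum_{j=1}^{n}|y_{j}-\mathbf{W}_{j}^{T}\hat{\boldsymbol{\beta}}|\,\|\mathcal{H}_{W}^{-1}\mathbf{W}_{j}\|},\quad i=1,\ldots,n,$$ then $\mathrm{tr}(V)$ (the asymptotic variance of $\tilde{\boldsymbol{\beta}}$) attains its minimum. (ii) If the subsampling probabilities are selected as $$\pi_{i}^{mV_{c}}=\frac{|y_{i}-\mathbf{W}_{i}^{T}\hat{\boldsymbol{\beta}}|\,\|\mathbf{W}_{i}\|}{\sum_{j=1}^{n}|y_{j}-\mathbf{W}_{j}^{T}\hat{\boldsymbol{\beta}}|\,\|\mathbf{W}_{j}\|},\quad i=1,\ldots,n,$$ then $\mathrm{tr}(V_{c})$ (the asymptotic variance of $\mathcal{H}_{W}\tilde{\boldsymbol{\beta}}$) attains its minimum.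
   Context: Model. For $i=1,\ldots,n$, $y_{i}=\mathbf{X}_{i}^{T}\boldsymbol{\beta}+\epsilon_{i}$ and $\mathbf{W}_{i}=\mathbf{X}_{i}+\mathbf{U}_{i}$, where $\mathbf{X}_{i}$ is a $p$-dimensional covariate vector, $y_i$ is the scalar response, $\boldsymbol{\beta}\in\mathbb{R}^{p}$ is unknown, $\epsilon_{i}$ is a random error with mean zero and variance $\sigma^{2}$, and $\mathbf{U}_{i}$ is a random measurement error vector with mean zero and known covariance matrix $\boldsymbol{\Sigma}_{uu}$, independent of $\epsilon_{i}$ and $\mathbf{X}_{i}$. Only $\mathbf{W}_i$ is observed. The full data are $\mathcal{F}_{n}=\{(\mathbf{W}_{i},y_{i}):i=1,\ldots,n\}$, regarded as given. $\|\cdot\|$ is the Euclidean norm. Full-data quantities. $\mathcal{H}_{W}=\frac{1}{n}\sum_{i=1}^{n}\mathbf{W}_{i}\mathbf{W}_{i}^{T}-\boldsymbol{\Sigma}_{uu}$ (invertible), and $\hat{\boldsymbol{\beta}}=\big(\sum_{i=1}^{n}\mathbf{W}_{i}\mathbf{W}_{i}^{T}-n\boldsymbol{\Sigma}_{uu}\big)^{-1}\sum_{i=1}^{n}\mathbf{W}_{i}y_{i}$. General subsampling. Given subsampling probabilities $\pi_{1},\ldots,\pi_{n}$ with $\sum_{i=1}^{n}\pi_{i}=1$, a random subsample $\{(\mathbf{W}_{i}^{*},y_{i}^{*})\}_{i=1}^{r}$ of size $r$ is drawn from the full data with replacement according to $\{\pi_i\}$, with $\pi_i^*$ the probability attached to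 the $i$-th drawn point, and $\tilde{\boldsymbol{\beta}}$ is the minimizer over $\boldsymbol{\beta}$ of $\frac{1}{2n}\sum_{i=1}^{r}\frac{1}{r\pi_{i}^{*}}(y_{i}^{*}-\mathbf{W}_{i}^{*T}\boldsymbol{\beta})^{2}-\frac12\boldsymbol{\beta}^{T}\boldsymbol{\Sigma}_{uu}\boldsymbol{\beta}$. The asymptotic covariance matrices (given $\mathcal{F}_n$) of $\tilde{\boldsymbol{\beta}}$ and $\mathcal{H}_W\tilde{\boldsymbol{\beta}}$ are, respectively, $$V=\mathcal{H}_{W}^{-1}V_{c}\mathcal{H}_{W}^{-1},\qquad V_{c}=\frac{1}{rn^{2}}\sum_{i=1}^{n}\frac{(y_{i}-\mathbf{W}_{i}^{T}\hat{\boldsymbol{\beta}})^{2}\mathbf{W}_{i}\mathbf{W}_{i}^{T}}{\pi_{i}}-\frac{1}{r}(\boldsymbol{\Sigma}_{uu}\hat{\boldsymbol{\beta}})(\boldsymbol{\Sigma}_{uu}\hat{\boldsymbol{\beta}})^{T}.$$ Minimizing $\mathrm{tr}(V)$ is called the A-optimality criterion and minimizing $\mathrm{tr}(V_c)$ the L-optimality criterion. *)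

(* Defs.v *)
(* MathComp / MathComp-Analysis *)
From HB Require Import structures.
From mathcomp Require Import all_boot all_order all_algebra.
From mathcomp Require Import all_classical all_reals all_analysis.

Set Implicit Arguments.
Unset Strict Implicit.
Unset Printing Implicit Defensive.

Import Order.TTheory GRing.Theory Num.Theory.
Local Open Scope classical_set_scope.
Local Open Scope ring_scope.

(* The norm `|v| that MathComp-Analysis puts on matrices is the max norm. *)
Definition enorm (R : realType) (p : nat) (v : 'cV[R]_p) : R :=
  Num.sqrt (\sum_(j < p) v j 0 ^+ 2).

Definition indep_systems (d : measure_display) (T : measurableType d)
    (R : realType) (P : probability T R) (F G : set_system T) : Prop :=
  forall A B : set T, F A -> G B -> P (A `&` B) = (P A * P B)%E.

Definition sigma_of_rv (d : measure_display) (T : measurableType d)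
    (R : realType) (e : T -> R) : set_system T :=
  preimage_set_system setT e measurable.

Definition sigma_of_vec (d : measure_display) (T : measurableType d)
    (R : realType) (p : nat) (Z : T -> 'cV[R]_p) : set_system T :=
  g_sigma_preimage (fun (j : 'I_p) (w : T) => Z w j 0).

(* The finite covariances, together with the zero means, force [eps i] and the
   entries of [U i] to be square integrable, so integrability is not a separate
   field. *)
Record measurement_error_model (d : measure_display) (T : measurableType d)
    (R : realType) (P : probability T R) (n p : nat)
    (beta : 'cV[R]_p) (sigma : R) (Suu : 'M[R]_p)
    (X U : 'I_n -> T -> 'cV[R]_p) (eps : 'I_n -> T -> R)
    (W : 'I_n -> T -> 'cV[R]_p) (y : 'I_n -> T -> R) : Prop := {
  mem_response : forall i w, y i w = ((X i w)^T *m beta) 0 0 + eps i w;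
  mem_observed : forall i w, W i w = X i w + U i w;
  mem_X_meas : forall i j, measurable_fun setT (fun w => X i w j 0);
  mem_U_meas : forall i j, measurable_fun setT (fun w => U i w j 0);
  mem_eps_meas : forall i, measurable_fun setT (eps i);
  mem_eps_mean : forall i, ('E_P[eps i] = 0)%E;
  mem_eps_var : forall i, ('V_P[eps i] = (sigma ^+ 2)%:E)%E;
  mem_U_mean : forall i j, ('E_P[(fun w => U i w j 0)%R] = 0)%E;
  mem_U_cov : forall i j k,
    covariance P (fun w => U i w j 0) (fun w => U i w k 0) = (Suu j k)%:E;
  mem_U_indep_eps : forall i,
    indep_systems P (sigma_of_vec (U i)) (sigma_of_rv (eps i));
  mem_U_indep_X : forall i,
    indep_systems P (sigma_of_vec (U i)) (sigma_of_vec (X i))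
}.

Section Subsampling.
Variables (R : realType) (n p : nat).
Variables (Suu : 'M[R]_p) (W : 'I_n -> 'cV[R]_p) (y : 'I_n -> R).

Definition HW : 'M[R]_p := n%:R^-1 *: \sum_(i < n) (W i *m (W i)^T) - Suu.

Definition beta_hat : 'cV[R]_p :=
  invmx (\sum_(i < n) (W i *m (W i)^T) - n%:R *: Suu)
  *m \sum_(i < n) (y i *: W i).

Definition resid (i : 'I_n) : R := y i - ((W i)^T *m beta_hat) 0 0.

Definition Vc (r : nat) (pi : 'I_n -> R) : 'M[R]_p :=
  (r%:R * n%:R ^+ 2)^-1
    *: \sum_(i < n) ((resid i ^+ 2 / pi i) *: (W i *m (W i)^T))
  - r%:R^-1 *: ((Suu *m beta_hat) *m (Suu *m beta_hat)^T).

Definition V (r : nat) (pi : 'I_n -> R) : 'M[R]_p :=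
  invmx HW *m Vc r pi *m invmx HW.

(* Since x / 0 = 0 here, a probability vector with [pi i = 0] at an index whose
   numerator in [Vc] is nonzero (where the variance is really infinite) must be
   excluded; at the other indices [pi i = 0] is harmless, with 0 / 0 = 0. *)
Definition subsampling_probabilities : set ('I_n -> R) :=
  [set pi | [/\ (forall i, 0 <= pi i), \sum_(i < n) pi i = 1 &
    forall i, pi i = 0 -> resid i ^+ 2 *: (W i *m (W i)^T) = 0]].

Definition mV_total : R :=
  \sum_(j < n) `|resid j| * enorm (invmx HW *m W j).

Definition pi_mV (i : 'I_n) : R :=
  `|resid i| * enorm (invmx HW *m W i) / mV_total.

Definition mVc_total : R := \sum_(j < n) `|resid j| * enorm (W j).

Definition pi_mVc (i : 'I_n) : R := `|resid i| * enorm (W i) / mVc_total.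

End Subsampling.

Definition attains_min (A : Type) (R : realType) (S : set A) (f : A -> R)
    (a : A) : Prop :=
  S a /\ forall b, S b -> f a <= f b.

(* Main.v *)
Require Import Defs.
From HB Require Import structures.
From mathcomp Require Import all_boot all_order all_algebra.
From mathcomp Require Import all_classical all_reals all_analysis.
From mathcomp Require Import ring.

Set Implicit Arguments.
Unset Strict Implicit.
Unset Printing Implicit Defensive.

Import Order.TTheory GRing.Theory Num.Theory.
Local Open Scope classical_set_scope.
Local Open Scope ring_scope.

(** Both criteria are instances of one: for an invertible matrix [A], minimise
    [tr (A Vc A^T)], with [A = 1] for L-optimality and [A = HW^-1] for
    A-optimality. The second instance uses that [HW^-1] is its own transpose,
    which holds because [Suu] is a covariance matrix and hence symmetric.

    Put [a i = |resid i| * ||A W_i||]. Since [tr (u u^T) = ||u||^2], the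
    criterion is [c * \sum_i a i ^+ 2 / pi i - K], where [c >= 0] and [K] do not
    depend on [pi] ([mxtrace_congr_Vc]). By Cauchy-Schwarz the sum is at least
    [(\sum_i a i) ^+ 2] when [\sum_i pi i = 1], with equality for [pi]
    proportional to [a] ([sum_sqr_div_ge], [sum_sqr_div_proportional]).

    Division by zero needs care. An admissible [pi] may vanish only where
    [resid i ^+ 2 *: W_i W_i^T = 0]; because [A] is invertible this is the same
    as [a i = 0] ([score_eq0]), so that [0 / 0 = 0] is the right contribution
    and the probabilities proportional to [a] are admissible. *)

(** This is Cauchy-Schwarz in tangent-line form: with [S = \sum_i a i], the
    inequality [a i ^+ 2 / q i >= 2 S a i - S ^+ 2 q i] amounts to
    [(a i - S q i) ^+ 2 >= 0], and summing it over [i] gives [2 S^2 - S^2].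
    The pointwise form also covers the indices with [q i = 0]. *)
Lemma sum_sqr_div_ge (F : realFieldType) (I : finType) (a q : I -> F)
    (q_ge0 : forall i, 0 <= q i) (q_sum1 : \sum_i q i = 1)
    (a_supp : forall i, q i = 0 -> a i = 0) :
  (\sum_i a i) ^+ 2 <= \sum_i a i ^+ 2 / q i.
Proof.
set S := \sum_i a i.
have -> : S ^+ 2 = \sum_i (2 * S * a i - S ^+ 2 * q i).
  by rewrite sumrB -!mulr_sumr q_sum1 -/S; ring.
apply: ler_sum => i _.
have [q0|q_neq0] := eqVneq (q i) 0.
  by rewrite q0 (a_supp _ q0) expr0n /= mul0r !mulr0 subr0.
have q_gt0 : 0 < q i by rewrite lt_neqAle eq_sym q_neq0 q_ge0.
rewrite ler_pdivlMr // -subr_ge0.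
have -> : a i ^+ 2 - (2 * S * a i - S ^+ 2 * q i) * q i = (a i - S * q i) ^+ 2.
  by ring.
exact: sqr_ge0.
Qed.

Lemma sum_sqr_div_proportional (F : fieldType) (I : finType) (a : I -> F)
    (S_neq0 : \sum_i a i != 0) :
  \sum_i a i ^+ 2 / (a i / \sum_j a j) = (\sum_i a i) ^+ 2.
Proof.
rewrite expr2 mulr_suml; apply: eq_bigr => i _.
have [->|a_neq0] := eqVneq (a i) 0; first by rewrite expr0n /= !mul0r.
by rewrite invf_div mulrCA expr2 mulfK // mulrC.
Qed.

Lemma enorm_sqr (R : realType) (p : nat) (v : 'cV[R]_p) :
  enorm v ^+ 2 = \sum_(j < p) v j 0 ^+ 2.
Proof. by rewrite sqr_sqrtr // sumr_ge0 // => j _; exact: sqr_ge0. Qed.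

Lemma mxtrace_outer (R : realType) (p : nat) (v : 'cV[R]_p) :
  \tr (v *m v^T) = enorm v ^+ 2.
Proof.
rewrite enorm_sqr; apply: eq_bigr => j _.
by rewrite !mxE big_ord1 mxE expr2.
Qed.

Lemma enorm_eq0 (R : realType) (p : nat) (v : 'cV[R]_p) :
  enorm v = 0 -> v = 0.
Proof.
move=> /(congr1 (fun t => t ^+ 2)).
rewrite enorm_sqr expr0n /= => /psumr_eq0P v0.
apply/matrixP => j k; rewrite ord1 mxE.
by apply/eqP; rewrite -sqrf_eq0 v0 // => i _; exact: sqr_ge0.
Qed.

Section LinearImage.
Variables (R : realType) (n p : nat).
Variables (Suu : 'M[R]_p) (W : 'I_n -> 'cV[R]_p) (y : 'I_n -> R).
Variable A : 'M[R]_p.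

Let res := resid Suu W y.

Definition score (i : 'I_n) : R := `|res i| * enorm (A *m W i).

Lemma score_sqr (i : 'I_n) :
  \tr (A *m (res i ^+ 2 *: (W i *m (W i)^T)) *m A^T) = score i ^+ 2.
Proof.
rewrite -scalemxAr -scalemxAl mxtraceZ exprMn real_normK ?num_real //.
by rewrite -mxtrace_outer trmx_mul !mulmxA.
Qed.

(** Invertibility of [A] is what makes a zero score reflect a zero numerator
    in [Vc], and not merely a numerator that [A] annihilates. *)
Lemma score_eq0 (A_unit : A \in unitmx) (i : 'I_n) :
  score i = 0 <-> res i ^+ 2 *: (W i *m (W i)^T) = 0.
Proof.
split=> [/eqP|num0].
  rewrite mulf_eq0 normr_eq0 => /orP[/eqP ->|/eqP /enorm_eq0 AW0].
    by rewrite expr0n /= scale0r.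
  by rewrite -[W i](mulKmx A_unit) AW0 mulmx0 mul0mx scaler0.
by apply/eqP; rewrite -sqrf_eq0 -score_sqr num0 mulmx0 mul0mx mxtrace0.
Qed.

Lemma mxtrace_congr_Vc (r : nat) (q : 'I_n -> R) :
  \tr (A *m Vc Suu W y r q *m A^T) =
    (r%:R * n%:R ^+ 2)^-1 * (\sum_i score i ^+ 2 / q i)
    - \tr (A *m (r%:R^-1 *: ((Suu *m beta_hat Suu W y)
                             *m (Suu *m beta_hat Suu W y)^T)) *m A^T).
Proof.
rewrite /Vc mulmxBr mulmxBl raddfB /=; congr (_ - _).
rewrite -scalemxAr -scalemxAl mxtraceZ; congr (_ * _).
rewrite mulmx_sumr mulmx_suml raddf_sum; apply: eq_bigr => i _ /=.
by rewrite -score_sqr -!scalemxAr -!scalemxAl !mxtraceZ mulrAC.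
Qed.

(** The hypothesis [S_neq0] is essential: if every score vanished, the proposed
    weights would all be [0 / 0 = 0] and would not sum to 1. *)
Lemma score_probabilities_optimal (r : nat) (A_unit : A \in unitmx)
    (S_neq0 : \sum_j score j != 0) :
  attains_min (subsampling_probabilities Suu W y)
    (fun q => \tr (A *m Vc Suu W y r q *m A^T))
    (fun i => score i / \sum_j score j).
Proof.
have score_ge0 i : 0 <= score i by rewrite mulr_ge0 // sqrtr_ge0.
split=> [|q [q_ge0 q_sum1 q_supp]].
  split=> [i||i /eqP]; first by rewrite divr_ge0 // sumr_ge0.
    by rewrite -mulr_suml divff.
  rewrite mulf_eq0 invr_eq0 (negbTE S_neq0) orbF => /eqP.
  by move/(score_eq0 A_unit).
rewrite !mxtrace_congr_Vc sum_sqr_div_proportional //.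
rewrite lerD2r ler_wpM2l ?invr_ge0 ?mulr_ge0 ?exprn_ge0 ?ler0n //.
by apply: sum_sqr_div_ge => // i /q_supp /(score_eq0 A_unit).
Qed.

End LinearImage.

Lemma measurement_error_cov_sym (d : measure_display) (T : measurableType d)
    (R : realType) (P : probability T R) (n p : nat)
    (beta : 'cV[R]_p) (sigma : R) (Suu : 'M[R]_p)
    (X U : 'I_n -> T -> 'cV[R]_p) (eps : 'I_n -> T -> R)
    (W : 'I_n -> T -> 'cV[R]_p) (y : 'I_n -> T -> R) (i : 'I_n) :
  measurement_error_model P beta sigma Suu X U eps W y -> Suu^T = Suu.
Proof.
move=> model; apply/matrixP => j k; rewrite mxE; apply: EFin_inj.
by rewrite -!(mem_U_cov model i) covarianceC.
Qed.

Lemma trmx_HW (R : realType) (n p : nat) (Suu : 'M[R]_p)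
    (W : 'I_n -> 'cV[R]_p) : Suu^T = Suu -> (HW Suu W)^T = HW Suu W.
Proof.
move=> Suu_sym; rewrite /HW raddfB /= linearZ /= raddf_sum Suu_sym.
congr (_ *: _ - _); apply: eq_bigr => i _ /=.
by rewrite trmx_mul trmxK.
Qed.

Theorem theorem3 (R : realType) (d : measure_display) (T : measurableType d)
    (P : probability T R) (n p r : nat)
    (beta : 'cV[R]_p) (sigma : R) (Suu : 'M[R]_p)
    (X U : 'I_n -> T -> 'cV[R]_p) (eps : 'I_n -> T -> R)
    (W : 'I_n -> T -> 'cV[R]_p) (y : 'I_n -> T -> R)
    (model : measurement_error_model P beta sigma Suu X U eps W y)
    (n_gt0 : (0 < n)%N) (r_gt0 : (0 < r)%N) (w : T)
    (Wo := fun i => W i w) (yo := fun i => y i w)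
    (HW_unit : HW Suu Wo \in unitmx) :
  (mV_total Suu Wo yo != 0 ->
     attains_min (subsampling_probabilities Suu Wo yo)
       (fun pi => \tr (V Suu Wo yo r pi)) (pi_mV Suu Wo yo)) /\
  (mVc_total Suu Wo yo != 0 ->
     attains_min (subsampling_probabilities Suu Wo yo)
       (fun pi => \tr (Vc Suu Wo yo r pi)) (pi_mVc Suu Wo yo)).
Proof.
split=> S_neq0.
  have Hinv_sym : (invmx (HW Suu Wo))^T = invmx (HW Suu Wo).
    rewrite trmx_inv trmx_HW //.
    exact: (measurement_error_cov_sym (Ordinal n_gt0) model).
  have Hinv_unit : invmx (HW Suu Wo) \in unitmx by rewrite unitmx_inv.
  have := score_probabilities_optimal r Hinv_unit S_neq0.
  by rewrite Hinv_sym.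
have score1 : score Suu Wo yo 1%:M =
    fun i => `|resid Suu Wo yo i| * enorm (Wo i).
  by apply/funext => i; rewrite /score mul1mx.
have trace1 : (fun q => \tr (1%:M *m Vc Suu Wo yo r q *m 1%:M^T)) =
    (fun q => \tr (Vc Suu Wo yo r q)).
  by apply/funext => q; rewrite trmx1 mulmx1 mul1mx.
have := @score_probabilities_optimal _ _ _ Suu Wo yo _ r (unitmx1 R p).
by rewrite score1 trace1; apply.
Qed.
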